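(* Let $k \geq 2$ be an integer, let $M$ be a $k$-connected binary matroid with at least $2(k-1)$ elements, and let $X$ be a non-empty independent set in $M$. Then the $\Gamma$-extension matroid $M^{X}$ is $k$-connected if and only if $|X| \geq k$ and $2 \leq k \leq 4$.
   Context: Let $M$ be a binary matroid with ground set $S$, represented over $GF(2)$ by a (standard) matrix $A$ whose columns are labeled by $S$. Let $X=\{x_1,\dots,x_m\}\subset S$ be a non-empty independent set of $M$ and let $\Gamma=\{\gamma_1,\dots,\gamma_m\}$ be a set disjoint from $S$. Let $A'$ be obtained from $A$ by adjoining $m$ new columns labeled $\gamma_1,\dots,\gamma_m$, where the column labeled $\gamma_i$ equals the column labeled $x_i$. Let $A^X$ be obtained from $A'$ by adjoining one extra row having entry $1$ in each column labeled $\gamma_i$ ($i=1,\dots,m$) and $0$ elsewhere. The $\Gamma$-extension $M^X$ of $M$ is the vector matroid of $A^X$ over $GF(2)$; its ground set is $S\cup\Gamma$. For an integer $j\ge 1$, a $j$-separation of a matroid $N$ with ground set $E$ and rank function $r$ is a partition of $E$ into disjoint sets $A,B$ with $\min\{|A|,|B|\}\ge j$ and $r(A)+r(B)-r(N)\le j-1$. A matroid is $k$-connected if it has no $j$-separation for any $j<k$. Throughout the paper all matroids are assumed loopless and coloopless. *)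

(* Defs.v *)
From HB Require Import structures.
From mathcomp Require Import all_boot all_order all_algebra.

Set Implicit Arguments.
Unset Strict Implicit.
Unset Printing Implicit Defensive.

Import GRing.Theory.

(* Matroids on a finite ground set (a whole finType), by independent sets.    *)

Record matroid (E : finType) := Matroid {
  indep :> pred {set E};
  indep_set0 : indep set0;
  indep_sub : forall I J : {set E}, I \subset J -> indep J -> indep I;
  indep_augment : forall I J : {set E}, indep I -> indep J -> #|I| < #|J| ->
    exists2 e, e \in J :\: I & indep (e |: I) }.

Section MatroidNotions.
Variables (E : finType) (M : matroid E).

Definition rank (A : {set E}) : nat :=
  \max_(I : {set E} | (I \subset A) && indep M I) #|I|.

Definition basis (B : {set E}) : bool := maxset (indep M) B.

Definition is_loop (e : E) : Prop := ~~ indep M [set e].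

Definition is_coloop (e : E) : Prop := forall B, basis B -> e \in B.

Definition loopless : Prop := forall e, ~ is_loop e.

Definition coloopless : Prop := forall e, ~ is_coloop e.

(* Used only for 1 <= j. The subtractions are those of nat; truncation of the *)
(* left-hand one at 0 does not change the truth of the inequality.            *)
Definition is_separation (j : nat) (A B : {set E}) : Prop :=
  [/\ A :|: B = setT, A :&: B = set0, j <= minn #|A| #|B|
    & rank A + rank B - rank setT <= j - 1].

Definition k_connected (k : nat) : Prop :=
  forall j, 1 <= j -> j < k -> ~ exists A B, is_separation j A B.

End MatroidNotions.

(* A matrix over GF(2) with n rows and columns labeled by E is given as the   *)
(* map sending each label to its column.                                      *)

Definition labeled_matrix (n : nat) (E : finType) := E -> 'cV['F_2]_n.

Section VectorMatroid.
Variables (n : nat) (E : finType) (A : labeled_matrix n E).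

(* Linear independence of the family (A e)_(e in I): equal columns with       *)
(* distinct labels are dependent.                                             *)
Definition cols_indep (I : {set E}) : bool := free [seq A e | e <- enum I].

Lemma cols_indep0 : cols_indep set0.
Proof. by rewrite /cols_indep enum_set0 nil_free. Qed.

Lemma cols_indepU1 (e : E) (I : {set E}) : e \notin I ->
  cols_indep (e |: I) = (A e \notin <<[seq A i | i <- enum I]>>%VS) && cols_indep I.
Proof.
move=> eI; rewrite /cols_indep -free_cons.
apply: (@perm_free _ _ _ (A e :: [seq A i | i <- enum I])).
rewrite -map_cons; apply: perm_map; apply: uniq_perm.
- exact: enum_uniq.
- by rewrite /= mem_enum eI enum_uniq.
- by move=> x; rewrite mem_enum !inE mem_enum.
Qed.

Lemma cols_indep_sub (I J : {set E}) : I \subset J -> cols_indep J -> cols_indep I.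
Proof.
move=> sIJ; rewrite /cols_indep.
have /perm_free -> : perm_eq [seq A e | e <- enum J]
    ([seq A e | e <- enum I] ++ [seq A e | e <- enum (J :\: I)]).
  rewrite -map_cat; apply: perm_map; apply: uniq_perm.
  - exact: enum_uniq.
  - rewrite cat_uniq !enum_uniq andbT /=; apply/hasPn=> x.
    by rewrite !mem_enum inE => /andP[].
  - move=> x; rewrite mem_cat !mem_enum inE.
    by have [/(subsetP sIJ)|] := boolP (x \in I).
exact: catl_free.
Qed.

Lemma cols_indep_augment (I J : {set E}) :
  cols_indep I -> cols_indep J -> #|I| < #|J| ->
  exists2 e, e \in J :\: I & cols_indep (e |: I).
Proof.
move=> fI fJ ltIJ; apply/exists_inP.
case: (boolP [exists e in J :\: I, cols_indep (e |: I)]) => // /exists_inPn noaug.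
suff /dimvS : (<<[seq A e | e <- enum J]>> <= <<[seq A e | e <- enum I]>>)%VS.
  move: (fI) (fJ); rewrite /cols_indep /free => /eqP-> /eqP->.
  by rewrite !size_map -!cardE leqNgt ltIJ.
apply/span_subvP => _ /mapP[e + ->]; rewrite mem_enum => eJ.
have [eI|eI] := boolP (e \in I).
  by apply: memv_span; apply: map_f; rewrite mem_enum.
have := noaug e; rewrite inE eI eJ => /(_ isT).
by rewrite cols_indepU1 // fI andbT negbK.
Qed.

Definition vector_matroid : matroid E :=
  Matroid cols_indep0 cols_indep_sub cols_indep_augment.

Definition represents (M : matroid E) : Prop :=
  forall I : {set E}, indep M I = indep vector_matroid I.

End VectorMatroid.

Section GammaExtension.
Variables (n : nat) (E : finType) (A : labeled_matrix n E) (X : {set E}).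

(* The new labels gamma_x are indexed by the elements x of X; the sum type    *)
(* makes them disjoint from E.                                                *)
Definition Gamma : finType := {x : E | x \in X}.

Definition matrix_adjoin_cols : labeled_matrix n (E + Gamma)%type :=
  fun e => match e with inl s => A s | inr g => A (val g) end.

Definition matrix_X : labeled_matrix (n + 1) (E + Gamma)%type :=
  fun e => col_mx (matrix_adjoin_cols e)
                  (match e with inl _ => 0%R | inr _ => const_mx 1%R end).

Definition Gamma_extension : matroid (E + Gamma)%type := vector_matroid matrix_X.

End GammaExtension.

(* Main.v *)
(* Gamma is a cocircuit of M^X, so it gives an |X|-separation when |X| < k;   *)
(* two elements of X with their copies form a circuit of size 4, which gives  *)
(* a 4-separation when k > 4. Conversely, let j < k <= 4 and let T, ~T be a   *)
(* bipartition of E + Gamma into parts of size at least j. If Gamma meets     *)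
(* both parts, the trace on E has connectivity at least one less, hence it is *)
(* a (j - 1)-separation of M unless one trace has at most j - 2 <= 1          *)
(* elements; if Gamma lies in T, the trace is a j-separation of M unless T    *)
(* has fewer than j elements in E. In these degenerate cases one uses that a  *)
(* set of fewer than k elements of M is independent with spanning complement. *)
Require Import Defs.
From mathcomp Require Import all_boot all_order all_algebra.
From mathcomp Require Import zify.

Set Implicit Arguments.
Unset Strict Implicit.
Unset Printing Implicit Defensive.

Import GRing.Theory.

(** Everything reduces to counting ranks. Write r and r' for the ranks of M and M^X. As the new row
    vanishes on E, r' agrees with r on subsets of E ([rank_inl]), while a set meeting Gamma has rank
    larger than that of its trace on E ([rank_meets_Gamma]); one extra row adds at most one, so the
    total rank is r(E) + 1 ([rank_Gamma_extension]). Forgetting the new row sends each gamma_x back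
    to x, which bounds r' from below ([rank_label], [rank_ge_card_Gamma]). Necessity is
    [k_connected_leq_card_X] and [k_connected_leq4]. For sufficiency these counts turn a separation
    of M^X into one of M, and [k_connected_small] with [rank_few_inl] handles traces too small to
    separate. *)

Section MatroidRank.
Variables (E : finType) (M : matroid E).
Implicit Types S T I : {set E}.

(** * Rank and connectivity in an arbitrary matroid *)

Lemma rank_witness S : exists I, [/\ I \subset S, indep M I & #|I| = rank M S].
Proof.
have [|I /andP[sIS iI] rI] := @eq_bigmax_cond _
  [pred I : {set E} | (I \subset S) && indep M I] (fun I => #|I|).
  by apply/card_gt0P; exists set0; rewrite inE sub0set indep_set0.
by exists I; split=> //; rewrite -rI.
Qed.

Lemma card_le_rank I S : I \subset S -> indep M I -> #|I| <= rank M S.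
Proof.
by move=> sIS iI; apply: (@leq_bigmax_cond _ _ (fun I => #|I|)); rewrite sIS.
Qed.

Lemma rank_leq_card S : rank M S <= #|S|.
Proof. by have [I [sIS _ <-]] := rank_witness S; apply: subset_leq_card. Qed.

Lemma rank_sub S T : S \subset T -> rank M S <= rank M T.
Proof.
move=> sST; have [I [sIS iI <-]] := rank_witness S.
by apply: card_le_rank => //; apply: subset_trans sST.
Qed.

Lemma rank_subadd S T : rank M (S :|: T) <= rank M S + rank M T.
Proof.
have [I [sI iI <-]] := rank_witness (S :|: T).
have -> : I = (I :&: S) :|: (I :&: T) by rewrite -setIUr; apply/esym/setIidPl.
apply: leq_trans (leq_card_setU _ _) _; apply: leq_add;
  by apply: card_le_rank; rewrite ?subsetIr ?(indep_sub _ iI) ?subsetIl.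
Qed.

Lemma rank_eq_card S : (rank M S == #|S|) = indep M S.
Proof.
apply/eqP/idP => [rS|iS]; last first.
  by apply/eqP; rewrite eqn_leq rank_leq_card card_le_rank.
have [I [sIS iI cI]] := rank_witness S.
by suff <- : I = S by []; apply/eqP; rewrite eqEcard sIS cI rS /=.
Qed.

Lemma not_separation k j S T : k_connected M k -> 0 < j < k ->
  S :|: T = setT -> S :&: T = set0 -> j <= #|S| -> j <= #|T| ->
  j + rank M setT <= rank M S + rank M T.
Proof.
move=> conM /andP[j_gt0 ltjk] ST dST leS leT; rewrite leqNgt; apply/negP=> lt.
by apply: (conM j) => //; exists S, T; split; rewrite ?leq_min ?leS //; lia.
Qed.

(** The bound on [#|E|] makes [S] no larger than its complement, so the pair would be a
    [#|S|]-separation unless both trivial upper bounds on the ranks are attained. *)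
Lemma k_connected_small k S :
  k_connected M k -> 2 * (k - 1) <= #|E| -> #|S| < k ->
  rank M S = #|S| /\ rank M (~: S) = rank M setT.
Proof.
move=> conM leE ltSk; have [->|S0] := eqVneq S set0.
  by rewrite setC0 cards0; split=> //; apply/eqP;
    rewrite -leqn0 -(cards0 E) rank_leq_card.
have cS := cardsC S; have S_gt0 : 0 < #|S| by rewrite card_gt0.
have := @not_separation k #|S| S (~: S) conM.
rewrite S_gt0 ltSk setUCr setICr => /(_ isT erefl erefl (leqnn _)) sep.
have {}sep := sep ltac:(lia).
have := rank_leq_card S; have := rank_sub (subsetT (~: S)); lia.
Qed.

End MatroidRank.

(** * Rank in a vector matroid as dimension of a span *)

Section VectorRank.
Variables (n : nat) (E : finType) (A : labeled_matrix n E).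
Local Notation cspan S := (<<[seq A e | e <- enum (S : {set E})]>>%VS).

Lemma rank_vector_matroid S : rank (vector_matroid A) S = \dim (cspan S).
Proof.
have dimI I : cols_indep A I -> \dim (cspan I) = #|I|.
  by rewrite /cols_indep /free => /eqP->; rewrite size_map -cardE.
have [I [sIS iI rI]] := rank_witness (vector_matroid A) S.
rewrite -rI -(dimI I iI); congr (\dim _); apply/eqP; rewrite eqEsubv.
apply/andP; split; apply/span_subvP => _ /mapP[e + ->]; rewrite mem_enum => eS.
  by rewrite memv_span // map_f // mem_enum (subsetP sIS).
have [eI|eI] := boolP (e \in I);
  first by rewrite memv_span // map_f // mem_enum.
have := @cols_indepU1 _ _ A e I eI; rewrite [cols_indep A I]iI andbT.
case: (boolP (A e \in _)) => //= _ ieI.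
have /= := @card_le_rank _ (vector_matroid A) (e |: I) S.
rewrite -rI cardsU1 eI ltnn => -> //.
by apply/subsetP=> x /setU1P[->|/(subsetP sIS)].
Qed.

End VectorRank.

Lemma rank_represents (n : nat) (E : finType) (A : labeled_matrix n E)
  (M : matroid E) (S : {set E}) :
  represents A M -> rank M S = rank (vector_matroid A) S.
Proof. by move=> AM; apply: eq_bigl => I; rewrite AM. Qed.

(** * Ranks in the extension *)

Section GammaExtension.
Variables (n : nat) (E : finType) (A : labeled_matrix n E) (X : {set E}).
Local Notation MA := (vector_matroid A).
Local Notation MX := (Gamma_extension A X).
Local Notation EX := (E + Gamma X)%type.
Implicit Types (S : {set E}) (T : {set EX}).

Let pad : 'Hom('cV['F_2]_n, 'cV['F_2]_(n + 1)) :=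
  linfun (mulmx (col_mx 1%:M 0%R)).

Lemma padE v : pad v = col_mx v 0%R.
Proof. by rewrite lfunE /= mul_col_mx mul1mx mul0mx. Qed.

Lemma lker_pad : lker pad == 0%VS.
Proof. by apply/lker0P=> u v; rewrite !padE => /eq_col_mx[]. Qed.

Lemma span_inl S :
  <<[seq matrix_X A e | e <- enum ((inl @: S)%SET : {set EX})]>>%VS
    = (pad @: <<[seq A e | e <- enum S]>>)%VS.
Proof.
rewrite limg_span -map_comp; apply: eq_span => v.
apply/mapP/mapP=> [[e + ->]|[e + ->]]; rewrite mem_enum.
  by case/imsetP=> s sS ->; exists s; rewrite ?mem_enum //= padE.
by move=> eS; exists (inl e); rewrite /= ?padE // mem_enum imset_f.
Qed.

Lemma rank_inl S : rank MX (inl @: S) = rank MA S.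
Proof.
by rewrite !rank_vector_matroid span_inl limg_dim_eq // (eqP lker_pad) capv0.
Qed.

(** A maximal independent subset of the trace stays independent after adding [g], whose last entry
    is 1 while the columns from [E] end in 0. *)
Lemma rank_meets_Gamma T g :
  inr g \in T -> rank MA (inl @^-1: T) < rank MX T.
Proof.
move=> gT; have [I [sIT iI <-]] := rank_witness MA (inl @^-1: T).
have gI : inr g \notin (inl @: I : {set EX}) by apply/imsetP=> -[].
have cI : #|(inl @: I : {set EX})| = #|I| by apply: card_imset => x y [].
rewrite -cI -add1n -[1]/(true : nat) -gI -cardsU1; apply: card_le_rank.
  apply/subsetP=> e /setU1P[->//|/imsetP[s /(subsetP sIT)]].
  by rewrite inE => sT ->.
rewrite /= cols_indepU1 // [cols_indep _ _](_ : _ = indep MX (inl @: I)) //.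
rewrite -rank_eq_card rank_inl cI rank_eq_card iI andbT span_inl.
apply/memv_imgP=> -[v _]; rewrite padE => /eq_col_mx[_ /matrixP/(_ 0 0)%R].
by rewrite !mxE.
Qed.

Lemma rank_Gamma_extension_leq T : rank MX T <= (rank MA setT).+1.
Proof.
rewrite !rank_vector_matroid -[leqRHS]addn1.
set V := <<[seq A e | e <- _]>>%VS;
  (* The last unit vector: each Gamma column is a padded column of [A] plus [u]. *)
  pose u : 'cV['F_2]_(n + 1) := col_mx 0%R (const_mx 1%R).
have sV : (<<[seq matrix_X A e | e <- enum T]>> <= pad @: V + <[u]>)%VS.
  apply/span_subvP=> _ /mapP[e _ ->].
  have mV s : pad (A s) \in (pad @: V)%VS.
    by rewrite memv_img // memv_span // map_f // mem_enum inE.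
  case: e => [s|g].
    have -> : matrix_X A (inl s) = pad (A s) by rewrite padE.
    by apply: (subvP (addvSl _ _)).
  suff -> : matrix_X A (inr g) = (pad (A (val g)) + u)%R.
    by rewrite memv_add ?memv_line.
  by rewrite padE add_col_mx addr0 add0r.
apply: leq_trans (dimvS sV) _; apply: leq_trans (dimv_add_leqif _ _).1 _.
apply: leq_add; first by rewrite -(limg_ker_dim pad V) leq_addl.
by rewrite dim_vline; case: (_ != _).
Qed.

(** The element whose column of [A] remains when the last row is deleted; [x] and [gamma_x] get the
    same label. *)
Definition label (e : EX) : E := match e with inl s => s | inr g => val g end.

Let proj : 'Hom('cV['F_2]_(n + 1), 'cV['F_2]_n) :=
  linfun (mulmx (row_mx 1%:M 0%R)).

Lemma proj_col_mx u v : proj (col_mx u v) = u.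
Proof. by rewrite lfunE /= mul_row_col mul1mx mul0mx addr0. Qed.

Lemma proj_span T :
  (proj @: <<[seq matrix_X A e | e <- enum T]>>)%VS
    = <<[seq A e | e <- enum (label @: T)%SET]>>%VS.
Proof.
rewrite limg_span -map_comp; apply: eq_span => v.
have projE e : proj (matrix_X A e) = A (label e).
  by rewrite proj_col_mx; case: e.
apply/mapP/mapP=> [[e + ->]|[e + ->]]; rewrite mem_enum.
  by move=> eT; exists (label e); rewrite /= ?projE // mem_enum imset_f.
by case/imsetP=> s sT ->; exists s; rewrite ?mem_enum //= projE.
Qed.

Lemma rank_label T : rank MA (label @: T) <= rank MX T.
Proof. by rewrite !rank_vector_matroid -proj_span -[leqRHS](limg_ker_dim proj)
  leq_addl. Qed.

(* The sum of the columns of x and gamma_x is the last unit vector, which     *)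
(* spans the kernel of the projection forgetting the last row.                *)
Lemma rank_label_twin T (g : Gamma X) :
  inl (val g) \in T -> inr g \in T -> rank MA (label @: T) < rank MX T.
Proof.
move=> xT gT; rewrite !rank_vector_matroid -proj_span.
set V := <<_>>%VS; rewrite -(limg_ker_dim proj V)
  -add1n leq_add2r lt0n dimv_eq0.
pose u : 'cV['F_2]_(n + 1) := (matrix_X A (inr g) - matrix_X A (inl (val g)
  : EX))%R.
have uE : u = col_mx 0%R (const_mx 1%R)
  by rewrite /u opp_col_mx add_col_mx subrr oppr0 addr0.
have uV : u \in (V :&: lker proj)%VS.
  rewrite memv_cap memv_ker uE proj_col_mx eqxx -uE andbT.
  by rewrite memvB // memv_span // map_f // mem_enum.
apply/eqP=> V0; move: uV; rewrite V0 memv0 uE => /eqP/matrixP/(_ (rshift n 0)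
  0)%R.
by rewrite col_mxEd !mxE.
Qed.

Lemma card_sum_set T : #|T| = #|inl @^-1: T| + #|inr @^-1: T|.
Proof.
rewrite -!sum1_card big_sumType /=.
by congr (_ + _); apply: eq_bigl => x; rewrite inE.
Qed.

Lemma rank_ge_card_Gamma T : indep MA X -> #|inr @^-1: T| <= rank MX T.
Proof.
move=> iX; rewrite -(card_imset _ val_inj); apply: leq_trans (rank_label T).
apply: card_le_rank; last first.
  by apply: indep_sub iX; apply/subsetP=> _ /imsetP[g _ ->]; apply: valP.
apply/subsetP=> _ /imsetP[g + ->]; rewrite inE => gT.
exact: (imset_f label gT).
Qed.

Lemma card_Gamma : #|Gamma X| = #|X|.
Proof. by rewrite card_sig; apply: eq_card => x; rewrite inE. Qed.

Lemma rank_Gamma_extension : X != set0 -> rank MX setT = (rank MA setT).+1.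
Proof.
case/set0Pn=> x xX; apply/eqP; rewrite eqn_leq rank_Gamma_extension_leq.
have := @rank_meets_Gamma setT (Sub x xX) (in_setT _).
by rewrite (_ : inl @^-1: setT = setT) //; apply/setP=> y; rewrite !inE.
Qed.

(** * Necessity of the bounds on [k] *)

Lemma k_connected_leq_card_X k :
  X != set0 -> k_connected MX k -> k <= #|X|.
Proof.
move=> X0 conX; rewrite leqNgt; apply/negP=> ltXk.
(* The sides are Gamma, of rank at most [#|X|], and [E], of rank one below the total. *)
pose G : {set EX} := inr @: [set: Gamma X];
  pose F : {set EX} := inl @: [set: E].
have cG : #|G| = #|X| by rewrite card_imset ?cardsT ?card_Gamma // => x y [].
have cF : #|F| = #|E| by rewrite card_imset ?cardsT // => x y [].
have := @not_separation _ MX k #|X| G F conX.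
rewrite card_gt0 X0 ltXk cG cF leqnn max_card rank_inl rank_Gamma_extension //.
have := rank_leq_card MX G; rewrite cG => leG sep.
have {}sep : #|X| + (rank MA setT).+1 <= rank MX G + rank MA setT.
  apply: sep => //; apply/setP=> -[s|g]; rewrite !inE.
  - by apply/orP; right; apply: imset_f.
  - by apply/orP; left; apply: imset_f.
  - by apply/negP=> /andP[/imsetP[]].
  - by apply/negP=> /andP[_ /imsetP[]].
lia.
Qed.

Lemma k_connected_leq4 k :
  1 < #|X| -> 8 <= #|E| + #|X| -> k_connected MX k -> k <= 4.
Proof.
case/card_gt1P=> x [y [xX yX neq_xy]] le8 conX; rewrite leqNgt;
  apply/negP=> lt4k.
pose gx : Gamma X := Sub x xX; pose gy : Gamma X := Sub y yX.
pose C3 : {set EX} := [set inl x; inl y; inr gx].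
have yC3 : inr gy \notin C3 by rewrite !inE /=;
  apply: contra neq_xy => /eqP[->].
have cC3 : #|C3| = 3 by rewrite /C3 setUC cardsU1 cards2 !inE /= neq_xy.
have cC : #|inr gy |: C3| = 4 by rewrite cardsU1 yC3 cC3.
have rC : rank MX (inr gy |: C3) < 4.
  rewrite -[ltnRHS]cC ltn_neqAle rank_leq_card rank_eq_card andbT /=
    cols_indepU1 //.
  rewrite negb_and negbK; apply/orP; left.
  have sp e : e \in C3 ->
    matrix_X A e \in <<[seq matrix_X A i | i <- enum C3]>>%VS.
    by move=> eC; rewrite memv_span // map_f // mem_enum.
  (* The 4-circuit: both differences [gamma_x - x] and [gamma_y - y] equal the last unit vector. *)
  have -> : matrix_X A (inr gy) =
      (matrix_X A (inr gx) - matrix_X A (inl x : EX)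
        + matrix_X A (inl y : EX))%R.
    rewrite /= opp_col_mx !add_col_mx.
    by rewrite subrr oppr0 !addr0 add0r.
  by rewrite memvD ?memvB // sp // !inE eqxx ?orbT.
have leCC : 4 <= #|~: (inr gy |: C3)|.
  by rewrite -(leq_add2l 4) -[in leqRHS]cC cardsC card_sum card_Gamma.
have := @not_separation _ MX k 4 _ _ conX lt4k (setUCr _) (setICr _)
  (eq_leq (esym cC)) leCC.
by rewrite leqNgt -addSn leq_add ?rank_sub ?subsetT.
Qed.

(** * Sufficiency *)

Section KConnected.
Variable k : nat.
Hypotheses (conA : k_connected MA k) (leE : 2 * (k - 1) <= #|E|).
Hypotheses (iX : indep MA X) (X0 : X != set0) (leX : k <= #|X|) (k4 : k <= 4).

(** At most one element of [T] lies in [E], so [T] cannot contain a 4-circuit formed by two elements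
    of [X] and their copies. Its Gamma part is independent, and a single [e] in [E] raises the rank:
    through the last unit vector if its copy is in [T], otherwise because fewer than [k] elements of
    [M] are independent. *)
Lemma rank_few_inl j T : j < k -> j <= #|T| -> #|inl @^-1: T| < j.-1 ->
  j <= rank MX T.
Proof.
move=> ltjk; rewrite card_sum_set => leT ltT.
have leG := rank_ge_card_Gamma T iX.
have [|lt_j] := leqP j #|inr @^-1: T|; first by move/leq_trans; apply.
(* Here [k <= 4] is used: it gives [j.-1 <= 2], and the trace is nonempty since Gamma provides fewer
   than [j] elements. *)
have /cards1P[e Te] : #|inl @^-1: T| == 1 by lia.
have eT : inl e \in T by have := set11 e; rewrite -Te inE.
pose Y := val @: (inr @^-1: T); have cY : #|Y| = #|inr @^-1: T| :=
  card_imset _ val_inj.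
have sY : e |: Y \subset label @: T.
  apply/subsetP=> x /setU1P[->|/imsetP[g + ->]];
    first exact: (imset_f label eT).
  by rewrite inE; apply: (imset_f label).
have Te1 : #|inl @^-1: T| = 1 by rewrite Te cards1.
have [/imsetP[g]|eY] := boolP (e \in Y).
  rewrite inE => gT eg; rewrite eg in eT.
  apply: leq_trans (rank_label_twin eT gT).
  have iY : indep MA Y.
    by apply: indep_sub iX; apply/subsetP=> _ /imsetP[h _ ->]; apply: valP.
  have := card_le_rank (subset_trans (subsetUr _ _) sY) iY; lia.
have cU : #|e |: Y| = #|Y|.+1 by rewrite cardsU1 eY.
have [|rU _] := @k_connected_small _ MA k (e |: Y) conA leE; first lia.
have := rank_label T; have := rank_sub MA sY; lia.
Qed.

Lemma preimCinl T : inl @^-1: (~: T) = ~: (inl @^-1: T).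
Proof. by apply/setP=> x; rewrite !inE. Qed.

Lemma no_separation_few_inl j T g :
  j < k -> j <= #|T| -> #|inl @^-1: T| < j.-1 -> inr g \notin T ->
  j + rank MX setT <= rank MX T + rank MX (~: T).
Proof.
move=> ltjk leT ltT gT; rewrite leq_add ?(rank_few_inl ltjk) //.
have := @rank_meets_Gamma (~: T) g; rewrite inE preimCinl => /(_ gT).
have [|_ ->] := @k_connected_small _ MA k (inl @^-1: T) conA leE; first lia.
by rewrite rank_Gamma_extension.
Qed.

Lemma no_separation_Gamma_split j T g h :
  0 < j < k -> j <= #|T| -> j <= #|~: T| -> inr g \in T -> inr h \notin T ->
  j + rank MX setT <= rank MX T + rank MX (~: T).
Proof.
move=> ltjk leT leCT gT hT; case/andP: (ltjk) => j_gt0 lt_jk.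
have hCT : inr h \in ~: T by rewrite inE.
have [/no_separation_few_inl|geT] := ltnP #|inl @^-1: T| j.-1; first by apply;
  eassumption.
have [ltCT|geCT] := ltnP #|inl @^-1: (~: T)| j.-1.
  by rewrite addnC [leqRHS]addnC addnC -{2}(setCK T)
    (@no_separation_few_inl _ _ g) // inE gT.
have := rank_meets_Gamma gT; have := rank_meets_Gamma hCT.
rewrite rank_Gamma_extension // preimCinl.
have := rank_subadd MA (inl @^-1: T) (~: (inl @^-1: T)); rewrite setUCr.
(* For [j = 1] there is no 0-separation to exclude, and subadditivity of the rank suffices. *)
have [j1|j_gt1] := leqP j 1; first lia.
rewrite preimCinl in geCT.
have := @not_separation _ MA k j.-1 _ _ conA _ (setUCr (inl @^-1: T))
  (setICr _) geT geCT.
by move=> /(_ ltac:(lia)); lia.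
Qed.

Lemma no_separation_Gamma_sub j T :
  0 < j < k -> j <= #|~: T| -> (forall g, inr g \in T) ->
  j + rank MX setT <= rank MX T + rank MX (~: T).
Proof.
move=> ltjk leCT GT; pose U := inl @^-1: T.
have TE : ~: T = inl @: (~: U).
  apply/setP=> -[s|g]; rewrite !inE.
    by apply/idP/imsetP=> [sT|[s' + [->]]]; [exists s;
      rewrite ?inE | rewrite !inE].
  by rewrite GT; apply/esym/negP=> /imsetP[].
have leCU : j <= #|~: U| by move: leCT; rewrite TE card_imset // => x y [].
rewrite TE rank_inl rank_Gamma_extension //.
have [ltU|geU] := ltnP #|U| j.
  have [|_ ->] := @k_connected_small _ MA k U conA leE; first lia.
  (* The complement of [U] already has full rank in [M]; the missing [j + 1] comes from Gamma, since
     [j < k <= #|X|]. *)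
  have := rank_ge_card_Gamma T iX.
  rewrite (_ : inr @^-1: T = setT); last by apply/setP=> g; rewrite !inE GT.
  by rewrite cardsT card_Gamma; lia.
have := not_separation conA ltjk (setUCr U) (setICr U) geU leCU.
case/set0Pn: X0 => x xX; have := rank_meets_Gamma (GT (Sub x xX)).
rewrite -/U; lia.
Qed.

Lemma k_connected_Gamma_extension : k_connected MX k.
Proof.
move=> j j_gt0 ltjk [T [T' [TT' dTT']]]; rewrite leq_min => /andP[leT leT'] sep.
have eT' : T' = ~: T.
  apply/setP=> e; rewrite inE; have := in_setT e; have := in_set0 e.
  by rewrite -TT' -dTT' !inE; case: (e \in T); case: (e \in T').
rewrite {}eT' in leT' sep; clear TT' dTT'.
suff : j + rank MX setT <= rank MX T + rank MX (~: T) by lia.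
have jk : 0 < j < k by rewrite j_gt0.
have [/forallP|/forallPn[h hT]] := boolP [forall g, inr g \in T].
  exact: no_separation_Gamma_sub.
have [/forallP GT|/forallPn[g]] := boolP [forall g, inr g \in ~: T]; last first.
  by rewrite inE negbK => gT; apply: no_separation_Gamma_split gT hT.
by rewrite [leqRHS]addnC -{2}(setCK T) no_separation_Gamma_sub // setCK.
Qed.

End KConnected.
End GammaExtension.

Theorem theorem2p6 (E : finType) (M : matroid E)
    (n : nat) (A : labeled_matrix n E) (X : {set E}) (k : nat) :
  represents A M -> loopless M -> coloopless M ->
  2 <= k -> k_connected M k -> 2 * (k - 1) <= #|E| ->
  X != set0 -> indep M X ->
  (k_connected (Gamma_extension A X) k <-> (k <= #|X| /\ 2 <= k <= 4)).
Proof.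
move=> AM _ _ k2 conM leE X0 iX.
have conA : k_connected (vector_matroid A) k.
  move=> j j1 jk [S [T [ST dST leST sep]]]; apply: (conM j) => //.
  by exists S, T; split; rewrite // !(rank_represents _ AM).
split=> [conX|[leX /andP[_ k4]]]; last first.
  by apply: k_connected_Gamma_extension; rewrite // -AM.
have leX := k_connected_leq_card_X X0 conX.
split=> //; rewrite k2 leqNgt; apply/negP=> k5.
(* The size conditions hold because [k >= 5] forces [#|E| >= 8] and [#|X| >= 5]. *)
by have := @k_connected_leq4 n E A X k _ _ conX; lia.
Qed.
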